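(* Let $f$ be an upper semi-continuous density on $\mathbb{R}^p$. Then $f$ is homothetic and log-concave if and only if there exist $K \in \mathcal{K}$, $\mu \in \mathbb{R}^p$ and $\phi \in \Phi$ such that $f(x) = e^{\phi(\|x - \mu\|_K)}$ for all $x \in \mathbb{R}^p$. If $f$ (of this form) has an alternative representation $f(\cdot) = e^{\tilde{\phi}(\|\cdot - \tilde{\mu}\|_{\tilde{K}})}$, where $\tilde{K} \in \mathcal{K}$, $\tilde{\mu} \in \mathbb{R}^p$ and $\tilde{\phi} \in \Phi$, then there exist $\sigma > 0$, $\sigma' > 0$ such that $\tilde{K} = \sigma K + \sigma'(\mu - \tilde{\mu})$ and $\tilde{\phi}(\cdot) = \phi(\sigma \cdot)$; moreover, if $f$ is not the density of a uniform distribution, then $\tilde{\mu} = \mu$.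
   Context: $\mathcal{K}$ is the set of compact, convex sets $K \subseteq \mathbb{R}^p$ with $0 \in \mathrm{int}(K)$. For $K \in \mathcal{K}$, the Minkowski functional is $\|x\|_K := \inf\{t \in [0,\infty) : x \in tK\}$. $\Phi$ is the set of upper semi-continuous, concave, decreasing (i.e. non-increasing) functions $\phi:[0,\infty) \to [-\infty,\infty)$; $e^{-\infty} := 0$. A density $f$ on $\mathbb{R}^p$ is \emph{homothetic} if there exist a decreasing (non-increasing) function $r:(0,\|f\|_\infty) \to [0,\infty)$, a measurable set $A \subseteq \mathbb{R}^p$ with $0 \in \mathrm{int}(A)$, and $\mu \in \mathbb{R}^p$ such that $\{x : f(x) \geq t\} = r(t)A + \mu$ for every $t \in (0,\|f\|_\infty)$, where $\|f\|_\infty := \sup_x f(x)$. It is log-concave if $\log f$ is concave (with $\log 0 := -\infty$). *)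

(* Defs.v *)
From HB Require Import structures.
From mathcomp Require Import all_boot all_order all_algebra.
From mathcomp Require Import all_classical all_reals all_analysis.
From mathcomp Require Import measurable_realfun.
Set Implicit Arguments.
Unset Strict Implicit.
Unset Printing Implicit Defensive.
Import Order.TTheory GRing.Theory Num.Theory.
Import numFieldNormedType.Exports.
Local Open Scope classical_set_scope.
Local Open Scope ring_scope.

Definition borel_rV (R : realType) (p : nat) :=
  g_sigma_algebraType (@open 'rV[R]_p).

(* Lebesgue measure on p.-tuples: the p-fold product of the one-dimensional
   Lebesgue measure, by recursion on p. The library has only binary products,
   and \x carries no sigma-finite instance usable here. *)
Section tuple_lebesgue.
Variable R : realType.
Local Open Scope ereal_scope.

Definition tuple_cons n (z : measurableTypeR R * n.-tuple (measurableTypeR R)) :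
  n.+1.-tuple (measurableTypeR R) := [tuple of z.1 :: z.2].

Lemma measurable_tuple_cons n : measurable_fun setT (@tuple_cons n).
Proof. exact: measurable_cons. Qed.

Section step.
Variables (n : nat)
  (m : {sigma_finite_measure set (n.-tuple (measurableTypeR R)) -> \bar R}).

Definition lebesgue_step : set (n.+1.-tuple (measurableTypeR R)) -> \bar R :=
  pushforward (@lebesgue_measure R \x m) (@tuple_cons n).

Let step0 : lebesgue_step set0 = 0.
Proof. by rewrite /lebesgue_step /pushforward preimage_set0 measure0. Qed.

Let step_ge0 A : 0 <= lebesgue_step A.
Proof. exact: (measure_ge0 (@lebesgue_measure R \x m)). Qed.

Let step_sigma_additive : semi_sigma_additive lebesgue_step.
Proof.
exact: (@measure_semi_sigma_additive _ _ _
  (measure_function_pushforward__canonical__measure_function_Measure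
    (@lebesgue_measure R \x m) (@measurable_tuple_cons n))).
Qed.

HB.instance Definition _ := isMeasure.Build _ _ _ lebesgue_step
  step0 step_ge0 step_sigma_additive.

Let step_sigma_finite : sigma_finite setT lebesgue_step.
Proof.
have /sigma_finiteP[F [FT ndF mF]] := sigma_finiteT (@lebesgue_measure R).
have /sigma_finiteP[G [GT ndG mG]] := sigma_finiteT m.
exists (fun k => [set t | F k (thead t) /\ G k [tuple of behead t]]).
  apply/esym/seteqP; split => // t _.
  have [i _ Fi] : (\bigcup_i F i) (thead t) by rewrite -FT.
  have [j _ Gj] : (\bigcup_j G j) [tuple of behead t] by rewrite -GT.
  exists (maxn i j) => //; split.
    by have /subsetPset := ndF _ _ (leq_maxl i j); apply.
  by have /subsetPset := ndG _ _ (leq_maxr i j); apply.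
move=> k; have [mFk Fk] := mF k; have [mGk Gk] := mG k; split.
  apply: measurableI.
    by rewrite -[X in measurable X]setTI; exact: measurable_tnth.
  by rewrite -[X in measurable X]setTI; exact: measurable_behead.
rewrite /lebesgue_step /pushforward.
have -> : @tuple_cons n @^-1` [set t | F k (thead t) /\ G k [tuple of behead t]]
    = F k `*` G k.
  apply/seteqP; split => -[x t] /=;
    by rewrite (_ : [tuple of _] = t) //; apply/val_inj.
by rewrite product_measure1E// lte_mul_pinfty// ge0_fin_numE.
Qed.

HB.instance Definition _ := Measure_isSigmaFinite.Build _ _ _ lebesgue_step
  step_sigma_finite.

End step.

Fixpoint tuple_lebesgue n :
    {sigma_finite_measure set (n.-tuple (measurableTypeR R)) -> \bar R} :=
  if n is n'.+1 then lebesgue_step (tuple_lebesgue n')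
  else \d_ ([tuple] : 0.-tuple (measurableTypeR R)).

End tuple_lebesgue.

Section lebesgue_rV.
Variables (R : realType) (p : nat).

Definition row_of_tuple (t : p.-tuple (measurableTypeR R)) : borel_rV R p :=
  \row_i tnth t i.

Lemma measurable_row_of_tuple : measurable_fun setT row_of_tuple.
Proof.
apply: (@measurability _ _ (p.-tuple (measurableTypeR R)) (borel_rV R p) _ _
  (@open 'rV[R]_p)) => //.
move=> _ [U oU <-]; rewrite setTI.
pose B (qk : 'rV[rat]_p * nat) : set (p.-tuple (measurableTypeR R)) :=
  \bigcap_(i in [set: 'I_p])
    [set t | `|ratr (qk.1 ord0 i) - tnth t i| < qk.2.+1%:R^-1].
have mB qk : measurable (B qk).
  apply: fin_bigcap_measurable => // i _.
  have mi : measurable_fun setT (fun t : p.-tuple (measurableTypeR R) =>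
      `|ratr (qk.1 ord0 i) - tnth t i| : R).
    apply: measurableT_comp => //; apply: measurable_funB => //.
    exact: measurable_tnth.
  rewrite -[X in measurable X]setTI.
  have := mi measurableT `]-oo, qk.2.+1%:R^-1[%classic (measurable_itv _).
  by congr measurable; apply/seteqP; split => t /=; rewrite in_itv.
have -> : row_of_tuple @^-1` U =
    \bigcup_(qk in [set qk | B qk `<=` row_of_tuple @^-1` U]) B qk.
  apply/seteqP; split => [t Ut|t [qk sB Bt]]; last exact: sB.
  have /nbhs_ballP[e e0 eU] : nbhs (row_of_tuple t : 'rV[R]_p) U.
    exact: open_nbhs_nbhs.
  pose k := Num.truncn (2 / e).
  have k2 : k.+1%:R^-1 < e / 2.
    rewrite -[ltRHS]invrK ltf_pV2 ?posrE ?invr_gt0 ?divr_gt0//.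
    by rewrite invf_div truncnS_gt.
  have /(_ _)/cid-/all_sig[q qP] (i : 'I_p) : exists q : rat,
      `|ratr q - tnth t i| < k.+1%:R^-1.
    have /rat_in_itvoo[q] : tnth t i - k.+1%:R^-1 < tnth t i + k.+1%:R^-1.
      by rewrite ltrBlDr -addrA ltrDl addr_gt0.
    by rewrite in_itv/= => qt; exists q; rewrite ltr_distl.
  exists (\row_i q i, k) => /=; last by move=> i _ /=; rewrite mxE.
  move=> s Bs; apply: eU; split => // i j; rewrite !mxE.
  have := Bs j I; rewrite /= mxE => sq.
  rewrite /ball/= (splitr e).
  rewrite -(subrKA (ratr (q j))).
  apply: (le_lt_trans (ler_normD _ _)); apply: ltrD.
    by rewrite distrC (lt_trans (qP j)).
  by rewrite (lt_trans sq).
rewrite bigcup_mkcond; apply: countable_bigcupT_measurable => //.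
by move=> qk; case: ifP.
Qed.

(* Lebesgue measure on the Borel sets of R^p; see lebesgue_rV_box for its value
   on boxes, which characterizes it. *)
Definition lebesgue_rV : set (borel_rV R p) -> \bar R :=
  pushforward (tuple_lebesgue R p) row_of_tuple.

Let lebesgue_rV0 : (lebesgue_rV set0 = 0)%E.
Proof. by rewrite /lebesgue_rV /pushforward preimage_set0 measure0. Qed.

Let lebesgue_rV_ge0 A : (0 <= lebesgue_rV A)%E.
Proof. exact: (measure_ge0 (tuple_lebesgue R p)). Qed.

Let lebesgue_rV_sigma_additive : semi_sigma_additive lebesgue_rV.
Proof.
exact: (@measure_semi_sigma_additive _ _ _
  (measure_function_pushforward__canonical__measure_function_Measure
    (tuple_lebesgue R p) measurable_row_of_tuple)).
Qed.

HB.instance Definition _ := isMeasure.Build _ _ _ lebesgue_rV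
  lebesgue_rV0 lebesgue_rV_ge0 lebesgue_rV_sigma_additive.

End lebesgue_rV.

Lemma tuple_lebesgue_box (R : realType) n (A : 'I_n -> set (measurableTypeR R)) :
  (forall i, measurable (A i)) ->
  tuple_lebesgue R n [set t | forall i, A i (tnth t i)] =
  (\prod_(i < n) lebesgue_measure (A i))%E.
Proof.
elim: n A => [|n IH] A mA.
  rewrite big_ord0 /= diracE mem_set //; by case.
rewrite big_ord_recl -IH /= /lebesgue_step /pushforward.
  rewrite -product_measure1E //; first last.
    rewrite (_ : [set t | _] = \bigcap_(i in [set: 'I_n])
      ((fun t : n.-tuple (measurableTypeR R) => tnth t i) @^-1` A (lift ord0 i))).
      apply: fin_bigcap_measurable => // i _.
      by rewrite -[X in measurable X]setTI; apply: measurable_tnth.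
    by apply/seteqP; split => t /= h i; [move=> _; exact: h|exact: (h i)].
  congr product_measure1; apply/seteqP; split => -[x t] /=.
    by move=> h; split => [|i]; [exact: (h ord0)|have := h (lift ord0 i); rewrite tnthS].
  move=> [h0 h] i; case: (unliftP ord0 i) => [j ->|->] //.
  by rewrite tnthS.
by move=> i; exact: mA.
Qed.

Lemma lebesgue_rV_box (R : realType) p (a b : 'rV[R]_p) :
  (forall i, a ord0 i <= b ord0 i) ->
  lebesgue_rV [set x : borel_rV R p | forall i, a ord0 i <= x ord0 i <= b ord0 i]
  = (\prod_(i < p) (b ord0 i - a ord0 i))%:E.
Proof.
move=> ab; rewrite /lebesgue_rV /pushforward.
rewrite (_ : _ @^-1` _ = [set t | forall i, `[a ord0 i, b ord0 i]%classic (tnth t i)]).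
  rewrite (tuple_lebesgue_box (A := fun i => `[a ord0 i, b ord0 i]%classic)) //.
  rewrite -prodEFin; apply: eq_bigr => i _.
  by rewrite lebesgue_measure_itv/= lte_fin; case: ltgtP (ab i) => // ->; rewrite subrr.
by apply/seteqP; split => t /= h i; have := h i; rewrite !mxE in_itv.
Qed.

Section definitions.
Variables (R : realType) (p : nat).
Implicit Types (f : 'rV[R]_p -> R) (A K : set 'rV[R]_p) (phi : R -> \bar R).
Local Open Scope ereal_scope.

(* Upper semicontinuity of the restriction of f to D; it is only used for
   functions that do not take the value +oo. *)
Definition upper_semicontinuous_on (X : topologicalType) (D : set X)
    (f : X -> \bar R) :=
  forall x (a : R), D x -> f x < a%:E ->
    \forall y \near within D (nbhs x), f y < a%:E.

(* Concavity on D of an extended-real-valued function that does not take the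
   value +oo, so that no sum below is of the form -oo + +oo. *)
Definition econcave_on (E : lmodType R) (D : set E) (g : E -> \bar R) :=
  forall x y (t : R), D x -> D y -> (0 < t < 1)%R ->
    t%:E * g x + (1 - t)%:E * g y <= g (t *: x + (1 - t) *: y)%R.

Definition is_density f :=
  [/\ forall x, (0 <= f x)%R,
      measurable_fun [set: borel_rV R p] (f : borel_rV R p -> R) &
      \int[lebesgue_rV (R := R) (p := p)]_x (f x)%:E = 1].

(* f is a density of the uniform distribution on some Borel set S of finite
   positive measure. *)
Definition uniform_density f :=
  exists S : set (borel_rV R p),
    [/\ measurable S, 0 < lebesgue_rV S < +oo &
      forall B : set (borel_rV R p), measurable B ->
        \int[lebesgue_rV (R := R) (p := p)]_(x in B) (f x)%:E =
        lebesgue_rV (B `&` S) / lebesgue_rV S].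

Definition scale_translate (c : R) A (v : 'rV[R]_p) : set 'rV[R]_p :=
  [set (c *: a + v)%R | a in A].

Definition sup_norm f : \bar R := ereal_sup [set (f x)%:E | x in setT].

(* sup_norm f is possibly +oo. r is only meaningful on the interval (0, sup_norm f). *)
Definition homothetic f :=
  exists (r : R -> R) (A : set 'rV[R]_p) (mu : 'rV[R]_p),
    [/\ forall t, (0 < t)%R -> t%:E < sup_norm f -> (0 <= r t)%R,
        forall s t, (0 < s <= t)%R -> t%:E < sup_norm f -> (r t <= r s)%R,
        measurable (A : set (borel_rV R p)),
        A° 0%R &
        forall t, (0 < t)%R -> t%:E < sup_norm f ->
          [set x | (t <= f x)%R] = scale_translate (r t) A mu].

Definition log_concave f := econcave_on setT (fun x => lne (f x)%:E).

Definition convex_body0 K :=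
  [/\ compact K, convex_set (K : set (convex_lmodType 'rV[R]_p)) & K° 0%R].

Definition minkowski_functional K (x : 'rV[R]_p) : R :=
  inf [set t : R | (0 <= t)%R /\ [set (t *: k)%R | k in K] x].

(* Functions on [0, +oo) are represented by functions on R of which only the
   values at nonnegative arguments matter. *)
Definition Phi phi :=
  [/\ forall s, (0 <= s)%R -> phi s < +oo,
      upper_semicontinuous_on [set s : R | (0 <= s)%R] phi,
      econcave_on (E := R^o) [set s : R | (0 <= s)%R] phi &
      forall s t, (0 <= s <= t)%R -> phi t <= phi s].

Definition homothetic_rep f K (mu : 'rV[R]_p) phi :=
  [/\ convex_body0 K, Phi phi &
      forall x, (f x)%:E = expeR (phi (minkowski_functional K (x - mu)%R))].

End definitions.

(* Main.v *)
(* Write ||.|| for the gauge of a convex body. If f is homothetic and log-concave,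
   its superlevel sets r(t) A + mu are closed and convex; one of them has an
   interior point and finite measure, hence is bounded, so A itself is a convex
   body and f(x) >= t iff ||x - mu||_A <= r(t). Thus f is a nonincreasing function
   of ||x - mu||_A, and phi is log f along a ray issued from mu. Conversely the
   superlevel sets of e^phi(||x - mu||_K) are r(t) K + mu with
   r(t) = max {s | t <= e^phi(s)}, finite because f is integrable.
   For uniqueness, compare the extreme values of each coordinate on
   r(t) K + mu = r'(t) K' + mu'. Their differences give r = sigma r' with sigma
   independent of t, and then mu - mu' = r'(t) c with c independent of t: if
   mu <> mu', then r' is constant and f takes a single nonzero value. *)
Require Import Defs.
From HB Require Import structures.
From mathcomp Require Import all_boot all_order all_algebra.
From mathcomp Require Import all_classical all_reals all_analysis.
From mathcomp Require Import measurable_realfun ring lra.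
Import Order.TTheory GRing.Theory Num.Theory.
Import numFieldNormedType.Exports.
Set Implicit Arguments.
Unset Strict Implicit.
Unset Printing Implicit Defensive.
Local Open Scope classical_set_scope.
Local Open Scope ring_scope.

(** Unbundles the coefficient, which [convex_set] carries together with its bounds, so that explicit
    real weights can be used below. *)
Lemma convex_set_combine (R : realType) (E : lmodType R) (A : set E) :
  convex_set (A : set (convex_lmodType E)) <->
  forall x y (t : R), 0 <= t <= 1 -> A x -> A y -> A (t *: x + (1 - t) *: y).
Proof.
split=> [cA x y t t01 Ax Ay|cA x y t /[!inE] Ax Ay].
  have := cA x y (Itv01 (proj1 (andP t01)) (proj2 (andP t01))).
  by rewrite !inE; apply.
by apply: (cA x y t%:num) => //; rewrite ge0 le1.
Qed.

(** * The gauge of a convex body *)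

Section minkowski.
Variables (R : realType) (p : nat) (K : set 'rV[R]_p).
Hypothesis bodyK : convex_body0 K.
Implicit Types (x y : 'rV[R]_p) (s t : R).

Lemma convex_body0_closed : closed K.
Proof. by have [cK _ _] := bodyK; apply: compact_closed. Qed.

Lemma convex_body0_combine x y t : 0 <= t <= 1 -> K x -> K y ->
  K (t *: x + (1 - t) *: y).
Proof. by have [_ + _] := bodyK; move/convex_set_combine; apply. Qed.

Lemma convex_body0_0 : K 0.
Proof. by have [_ _ /nbhs_singleton] := bodyK. Qed.

Lemma convex_body0_scale x t : 0 <= t <= 1 -> K x -> K (t *: x).
Proof.
move=> t01 Kx; rewrite -[_ *: _]addr0 -[in X in _ + X](scaler0 _ (1 - t)).
exact: convex_body0_combine convex_body0_0.
Qed.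

(** As [K] is convex and contains 0, it contains [(s / t) *: k] along with [k]. The case [t = 0],
    where the quotient is meaningless, forces [s = 0]. *)
Lemma convex_body0_dilate x s t : 0 <= s <= t ->
  [set s *: k | k in K] x -> [set t *: k | k in K] x.
Proof.
move=> /andP[s0 st] [k Kk <-].
have [t0|t0] := eqVneq t 0.
  have -> : s = 0 by apply/le_anti; rewrite s0 -t0 st.
  by exists 0; [exact: convex_body0_0|rewrite scaler0 scale0r].
have tp : 0 < t by rewrite lt_neqAle eq_sym t0 (le_trans s0).
exists ((s / t) *: k); last by rewrite scalerA mulrCA divff// mulr1.
by apply: convex_body0_scale => //; rewrite divr_ge0 ?(ltW tp)//= ler_pdivrMr// mul1r.
Qed.

Lemma convex_body0_absorbing x : exists2 t, 0 < t & [set t *: k | k in K] x.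
Proof.
have [_ _ /nbhs_ballP[e /= e0 eK]] := bodyK.
(* [t^-1 *: x] has norm below [e]; adding 1 keeps [t] positive and the inequality strict when
   [x = 0]. *)
pose t := (`|x| + 1) / e.
have tp : 0 < t by rewrite divr_gt0// ltr_wpDl.
exists t => //; exists (t^-1 *: x); last by rewrite scalerA divff ?scale1r// gt_eqF.
apply: eK; rewrite -ball_normE /= sub0r normrN normrZ gtr0_norm ?invr_gt0//.
rewrite /t invf_div mulrAC ltr_pdivrMr ?ltr_wpDl//.
by rewrite ltr_pM2l// ltrDl.
Qed.

Lemma minkowski_ge0 x : 0 <= minkowski_functional K x.
Proof.
apply: lb_le_inf; last by move=> t [].
by have [t /ltW t0 tx] := convex_body0_absorbing x; exists t.
Qed.

(** The infimum is attained: [x] lies in every dilate of [K] by a factor above [s], and the passage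
    to the limit uses that [K] is closed if [s > 0] and bounded if [s = 0]. *)
Lemma minkowski_le x s : 0 <= s ->
  minkowski_functional K x <= s <-> [set s *: k | k in K] x.
Proof.
move=> s0; split=> [ms|sx]; last first.
  by apply: ge_inf; [exists 0 => t []|split].
have above u : s < u -> [set u *: k | k in K] x.
  move=> su; have [||t [t0 tx] tu] := @inf_lt R
      [set t | 0 <= t /\ [set t *: k | k in K] x] u.
  - by have [t /ltW t0 tx] := convex_body0_absorbing x; exists t.
  - exact: le_lt_trans su.
  by apply: convex_body0_dilate tx; rewrite t0 ltW.
move: s0; rewrite le_eqVlt => /predU1P[s0|sp].
  exists 0; first exact: convex_body0_0.
  rewrite scaler0; apply/esym/eqP; rewrite -normr_le0.
  have [cK _ _] := bodyK.
  have [M [_ /(_ (`|M| + 1))]] := compact_bounded cK.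
  have M1 : 0 < `|M| + 1 by rewrite ltr_wpDl.
  rewrite (le_lt_trans (ler_norm M)) ?ltrDl// => /(_ erefl) KM.
  apply/ler_addgt0Pl => e e0; rewrite addr0.
  (* Points of [K] have norm at most [|M| + 1], so this factor yields [|x| <= e]. *)
  have [|k Kk <-] := above (e / (`|M| + 1)); first by rewrite -s0 divr_gt0.
  rewrite normrZ gtr0_norm ?divr_gt0// mulrAC ler_pdivrMr// ler_pM2l//.
  exact: KM.
suff : K (s^-1 *: x).
  by exists (s^-1 *: x) => //; rewrite scalerA divff ?scale1r// gt_eqF.
have := convex_body0_closed; apply.
move=> B /nbhs_ballP[e /= e0 eB].
pose d := e / (`|x| + 1).
have d0 : 0 < d by rewrite divr_gt0// ltr_wpDl.
(* [u^-1] is below [s^-1] by at most [d], which puts [u^-1 *: x] within [e] of [s^-1 *: x], and by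
   at most half of [s^-1], which keeps [u] positive. *)
pose u := (s^-1 - Num.min d (s^-1 / 2))^-1.
have sV : 0 < s^-1 by rewrite invr_gt0.
have m0 : 0 < Num.min d (s^-1 / 2) by rewrite lt_min d0 divr_gt0.
have m1 : Num.min d (s^-1 / 2) <= d by rewrite ge_min lexx.
have m2 : Num.min d (s^-1 / 2) <= s^-1 / 2 by rewrite ge_min lexx orbT.
have uV : 0 < s^-1 - Num.min d (s^-1 / 2) by lra.
have [|k Kk kx] := above u.
  by rewrite /u -[ltLHS]invrK ltf_pV2 ?posrE//; lra.
exists (u^-1 *: x); split.
  by rewrite -kx scalerA mulVf ?scale1r// gt_eqF// invr_gt0.
apply: eB; rewrite -ball_normE /= -scalerBl normrZ /u invrK subKr gtr0_norm//.
apply: (@le_lt_trans _ _ (d * `|x|)); first by rewrite ler_wpM2r.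
by rewrite /d mulrAC ltr_pdivrMr ?ltr_wpDl// ltr_pM2l// ltrDl.
Qed.

Lemma minkowski_attained x : [set minkowski_functional K x *: k | k in K] x.
Proof. by apply/minkowski_le => //; exact: minkowski_ge0. Qed.

Lemma minkowski0 : minkowski_functional K 0 = 0.
Proof.
apply/le_anti; rewrite minkowski_ge0 andbT.
by apply/minkowski_le => //; exists 0; [exact: convex_body0_0|rewrite scaler0].
Qed.

Lemma minkowski_gt0 x : x != 0 -> 0 < minkowski_functional K x.
Proof.
move=> x0; rewrite lt_neqAle minkowski_ge0 andbT; apply: contraNN x0 => /eqP m0.
by have [k _ <-] := minkowski_attained x; rewrite -m0 scale0r.
Qed.

Lemma minkowski_scale_le x s : 0 <= s ->
  minkowski_functional K (s *: x) <= s * minkowski_functional K x.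
Proof.
move=> s0; apply/minkowski_le; first by rewrite mulr_ge0// minkowski_ge0.
by have [k Kk kx] := minkowski_attained x; exists k; rewrite // -scalerA kx.
Qed.

(** The preceding inequality is applied to [s] and to its inverse. *)
Lemma minkowskiZ x s : 0 <= s ->
  minkowski_functional K (s *: x) = s * minkowski_functional K x.
Proof.
rewrite le_eqVlt => /predU1P[<-|s0]; first by rewrite scale0r mul0r minkowski0.
apply/le_anti; rewrite minkowski_scale_le ?(ltW s0)//= mulrC -ler_pdivlMr//.
rewrite mulrC -[X in minkowski_functional K X <= _](@scalerK _ _ s) ?gt_eqF//.
by apply: minkowski_scale_le; rewrite invr_ge0 ltW.
Qed.

Lemma minkowski_convex x y t : 0 <= t <= 1 ->
  minkowski_functional K (t *: x + (1 - t) *: y) <=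
  t * minkowski_functional K x + (1 - t) * minkowski_functional K y.
Proof.
move=> /andP[t0 t1].
set a := minkowski_functional K x; set b := minkowski_functional K y.
have a0 : 0 <= t * a by rewrite mulr_ge0// minkowski_ge0.
have b0 : 0 <= (1 - t) * b by rewrite mulr_ge0 ?subr_ge0// minkowski_ge0.
apply/minkowski_le; first exact: addr_ge0.
have [k Kk <-] := minkowski_attained x; have [l Kl <-] := minkowski_attained y.
rewrite -/a -/b !scalerA; set c := t * a; set d := (1 - t) * b.
(* Otherwise [c *: k + d *: l] is [c + d] times the convex combination of [k] and [l] with weights
   [c / (c + d)] and [d / (c + d)]. *)
have [cd0|cd0] := eqVneq (c + d) 0.
  have -> : c = 0 by apply/le_anti; rewrite a0 -cd0 lerDl b0.
  have -> : d = 0 by apply/le_anti; rewrite b0 -cd0 lerDr a0.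
  by exists 0; [exact: convex_body0_0|rewrite !(scale0r, addr0)].
have cdp : 0 < c + d by rewrite lt_neqAle eq_sym cd0 addr_ge0.
exists ((c / (c + d)) *: k + (1 - c / (c + d)) *: l).
  apply: convex_body0_combine => //.
  by rewrite divr_ge0 ?(ltW cdp)//= ler_pdivrMr// mul1r lerDl.
rewrite scalerDr !scalerA mulrBr mulr1 mulrCA divff// mulr1.
by rewrite [c + d]addrC addrK.
Qed.

(** On the ray spanned by such a [u] the gauge is the parameter itself, so a function of the gauge
    can be read off there. *)
Lemma minkowski_unit : (0 < p)%N -> exists u, minkowski_functional K u = 1.
Proof.
move=> p0.
have /minkowski_gt0 c0 : (const_mx 1 : 'rV[R]_p) != 0.
  apply/eqP => /matrixP/(_ ord0 (Ordinal p0)); rewrite !mxE => /eqP.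
  by rewrite oner_eq0.
exists ((minkowski_functional K (const_mx 1))^-1 *: const_mx 1).
by rewrite minkowskiZ ?invr_ge0 ?(ltW c0)// mulVf// gt_eqF.
Qed.

End minkowski.

(** * Lebesgue measure of convex sets, and densities *)

Section lebesgue_rV_facts.
Variables (R : realType) (p : nat).
Local Notation lambda := (@lebesgue_rV R p).
Implicit Types (x c : 'rV[R]_p) (C : set 'rV[R]_p).

Lemma closed_measurable_rV C :
  closed C -> measurable (C : set (borel_rV R p)).
Proof.
move=> cC; rewrite -[C]setCK; apply: measurableC.
by apply: sub_sigma_algebra; exact: closed_openC.
Qed.

Lemma closed_rV_cube c (d : R) :
  closed [set x : 'rV[R]_p | forall i, c ord0 i - d <= x ord0 i <= c ord0 i + d].
Proof.
rewrite (_ : [set x | _] = \bigcap_i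
    ((fun x : 'rV[R]_p => x ord0 i) @^-1` `[c ord0 i - d, c ord0 i + d])).
  apply: closed_bigI => i _; apply: closed_comp => [x _|].
    exact: coord_continuous.
  exact: itv_closed.
apply/seteqP; split=> x /= xb i => [_|].
  by rewrite /= in_itv/=; exact: xb.
by have := xb i I; rewrite /= in_itv.
Qed.

Lemma lebesgue_rV_cube c (d : R) : 0 <= d ->
  lambda [set x | forall i, c ord0 i - d <= x ord0 i <= c ord0 i + d] =
  ((d *+ 2) ^+ p)%:E.
Proof.
move=> d0; have := @lebesgue_rV_box R p (c - const_mx d) (c + const_mx d).
rewrite (_ : [set x : borel_rV R p | _] =
    [set x | forall i, c ord0 i - d <= x ord0 i <= c ord0 i + d]); last first.
  by apply/seteqP; split=> x /= xb i; have := xb i; rewrite !mxE.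
move=> -> => [|i]; last by rewrite !mxE; lra.
congr EFin; under eq_bigr => i _.
  rewrite (_ : _ - _ = d *+ 2); last by rewrite !mxE; lra.
  over.
by rewrite prodr_const card_ord.
Qed.

(** A point is a cube of side 0, and [0 ^+ p] vanishes for positive [p]. *)
Lemma lebesgue_rV_set1 x : (0 < p)%N -> lambda [set x] = 0%E.
Proof.
move=> p0; rewrite (_ : [set x] =
    [set y | forall i, x ord0 i - 0 <= y ord0 i <= x ord0 i + 0]).
  by rewrite lebesgue_rV_cube// mul0rn expr0n eqn0Ngt p0.
apply/seteqP; split=> y /= => [-> i|yx]; first by rewrite subr0 addr0 lexx.
by apply/rowP => i; apply/le_anti; have := yx i; rewrite subr0 addr0 andbC.
Qed.

(* If x in C is far from the interior point c, then C contains many disjoint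
   cubes of a fixed size centred on the segment from c to (c + x) / 2. *)
Lemma convex_finite_measure_bounded C c :
  convex_set (C : set (convex_lmodType 'rV[R]_p)) -> C° c ->
  measurable (C : set (borel_rV R p)) -> (lambda C < +oo)%E ->
  exists M, forall x, C x -> `|x - c| <= M.
Proof.
move=> /convex_set_combine cC /nbhs_ballP[e /= e0 eC] mC fC.
pose d := e / 4; have d0 : 0 < d by rewrite /d; lra.
pose v := (d *+ 2) ^+ p; have v0 : 0 < v by rewrite exprn_gt0// mulrn_wgt0.
have lC : lambda C \is a fin_num by rewrite ge0_fin_numE ?measure_ge0.
(* The total measure of [n] disjoint cubes of volume [v] exceeds that of [C]. *)
pose n := (Num.truncn (fine (lambda C) / v)).+1.
have nv : fine (lambda C) < n%:R * v.
  by rewrite -ltr_pdivrMr// truncnS_gt.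
have n0 : 0 < n%:R :> R by rewrite ltr0n.
exists (4 * n%:R * d) => x Cx; rewrite leNgt; apply/negP => xfar.
(* The norm is the largest absolute value of a coordinate; the cubes will be separated in the
   coordinate [q] that realizes it. *)
have [[i0 q] /= xq] : exists i, `|x - c| = `|(x - c) i.1 i.2|.
  apply: mx_norm_neq0; rewrite gt_eqF// (le_lt_trans _ xfar)//.
  by rewrite !mulr_ge0// ltW.
rewrite (ord1 i0) {i0} in xq.
(* Since [th i <= 1 / 2], the homothety of centre [x] and ratio [1 - th i] maps the [e]-ball about
   [c] onto a ball about [z i] of radius at least [e / 2 = 2 * d], which contains the cube [B i]. *)
pose th (i : 'I_n) : R := i%:R / (2 * n%:R).
pose z i := c + th i *: (x - c).
pose B i := [set y : 'rV[R]_p |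
  forall j, z i ord0 j - d <= y ord0 j <= z i ord0 j + d].
have th0 i : 0 <= th i by rewrite divr_ge0 ?mulr_ge0// ltW.
have th1 i : th i <= 1 / 2.
  rewrite ler_pdivrMr ?mulr_gt0// mulrA divfK ?pnatr_eq0//.
  by rewrite mul1r ler_nat ltnW.
have BC i : B i `<=` C.
  move=> y By.
  have t1 := th1 i; have t0 : 0 < 1 - th i by lra.
  rewrite (_ : y = th i *: x +
      (1 - th i) *: (c + (1 - th i)^-1 *: (y - z i))); last first.
    rewrite [in RHS]scalerDr scalerA divff ?gt_eqF// scale1r /z.
    by apply/rowP => j; rewrite !mxE; ring.
  apply: cC => //; first by rewrite th0/=; lra.
  apply: eC; split=> // k j; rewrite (ord1 k) /ball/= !mxE.
  rewrite opprD addNKr normrN normrM gtr0_norm ?invr_gt0//.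
  rewrite mulrC ltr_pdivrMr//.
  have : `|y ord0 j - z i ord0 j| <= d by rewrite ler_distl; exact: By.
  rewrite !mxE => /le_lt_trans; apply.
  have : e * (1 / 2) <= e * (1 - th i) by rewrite ler_pM2l//; lra.
  by rewrite /d; lra.
have tB : trivIset [set: 'I_n] B.
  move=> i j _ _ [y [Bi Bj]]; apply/eqP/negPn/negP => ij.
  have zz : `|z i ord0 q - z j ord0 q| <= d *+ 2.
    by have /andP[? ?] := Bi q; have /andP[? ?] := Bj q; rewrite ler_norml; lra.
  (* A common point puts the centres within [2 * d] in coordinate [q], while [|x - c| > 4 * n * d].
     Hence [|i - j| < 1], and the indices, being integers, agree. *)
  have : `|th i - th j| * (4 * n%:R * d) < d *+ 2.
    apply: (lt_le_trans _ zz).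
    have -> : z i ord0 q - z j ord0 q = (th i - th j) * (x - c) ord0 q.
      by rewrite !mxE; ring.
    rewrite normrM -xq ltr_pM2l// normr_gt0 subr_eq0 /th -subr_eq0 -mulrBl.
    rewrite mulf_eq0 subr_eq0 eqr_nat negb_or ij/=.
    by rewrite invr_eq0 gt_eqF// mulr_gt0.
  rewrite /th -mulrBl normrM [`|_^-1|]gtr0_norm ?invr_gt0 ?mulr_gt0//.
  rewrite (_ : _ * _ = `|i%:R - j%:R| * (d *+ 2)); last first.
    by field; rewrite gt_eqF.
  rewrite -ltr_pdivlMr ?divff ?gt_eqF ?mulrn_wgt0// => ij1.
  have : (`|i%:Z - j%:Z|%:~R : R) < 1%:~R by rewrite intr_norm rmorphB.
  rewrite ltr_int -[1]add0r ltzD1 normr_le0 subr_eq0 => /eqP[] /val_inj ij'.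
  by rewrite ij' eqxx in ij.
have mB i : measurable (B i : set (borel_rV R p)).
  by exact: closed_measurable_rV (@closed_rV_cube _ _).
have : (lambda (\big[setU/set0]_(i < n) B i) <= lambda C)%E.
  rewrite le_measure ?inE//; first exact: bigsetU_measurable.
  by rewrite -bigcup_mkord_ord => y [i _]; exact: BC.
apply/negP; rewrite -ltNge measure_bigsetU_ord//.
rewrite (eq_bigr (fun=> v%:E)) => [|i _]; last first.
  exact: lebesgue_rV_cube (ltW d0).
rewrite sumEFin sumr_const card_ord -[lambda C]fineK// lte_fin.
by rewrite -mulr_natl.
Qed.

(** * Superlevel sets and support of a density *)

Lemma integral_const_indic (B S : set (borel_rV R p)) (m : R) : 0 <= m ->
  measurable B -> measurable S ->
  (\int[lambda]_(x in B) (m * \1_S x)%:E = m%:E * lambda (B `&` S))%E.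
Proof.
move=> m0 mB mS; under eq_integral do rewrite EFinM.
rewrite ge0_integralZl_EFin//; first by rewrite integral_indic// setIC.
by apply/measurable_EFinP/measurable_indic.
Qed.

Variable f : 'rV[R]_p -> R.
Hypothesis f_density : is_density f.

Lemma density_ge0 x : 0 <= f x.
Proof. by have [] := f_density. Qed.

Lemma density_superlevel_measurable (t : R) :
  measurable ([set x | t <= f x] : set (borel_rV R p)).
Proof.
have [_ /(_ measurableT `[t, +oo[%classic (measurable_itv _)) + _] := f_density.
rewrite setTI; congr measurable.
by apply/seteqP; split=> x /=; rewrite in_itv/= andbT.
Qed.

(** Markov's inequality: [t] times the indicator of [L] is at most [f], so [t * lambda L <= 1]. *)
Lemma density_superlevel_finite (t : R) : 0 < t ->
  (lambda [set x | (t <= f x)%R] < +oo)%E.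
Proof.
move=> t0; have [f0 mf f1] := f_density; set L := [set x | _].
have mL : measurable (L : set (borel_rV R p)).
  exact: density_superlevel_measurable.
have : (t%:E * lambda L <= 1)%E.
  rewrite -[L]setTI -integral_const_indic ?(ltW t0)// -f1.
  apply: ge0_le_integral => //.
  - by move=> x _; rewrite lee_fin mulr_ge0 ?(ltW t0).
  - apply/measurable_EFinP/measurable_funM => //; exact: measurable_indic.
  - exact/measurable_EFinP.
  move=> x _; rewrite lee_fin indicE.
  by case: (boolP (x \in L)) => [/set_mem Lx|_]; rewrite ?mulr1 ?mulr0.
case: (lambda L) => [s _|+|_]; [exact: ltry| |by []].
by rewrite mulry gtr0_sg// mul1e.
Qed.

(** Otherwise [f] vanishes off a null set and its integral is 0. *)
Lemma density_support_neq c : (0 < p)%N -> exists2 x, x != c & 0 < f x.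
Proof.
move=> p0; have [f0 mf f1] := f_density; apply/not_exists2P => fc.
suff : (\int[lambda]_x (f x)%:E = 0)%E by rewrite f1 => /eqP; rewrite eqe oner_eq0.
have mc : measurable ([set c] : set (borel_rV R p)).
  by apply: closed_measurable_rV; apply: compact_closed => //; exact: compact_set1.
rewrite (eq_integral (fun x : borel_rV R p => (f c * \1_[set c] x)%:E)).
  by rewrite integral_const_indic// setTI lebesgue_rV_set1// mule0.
move=> x _; congr EFin; rewrite indicE.
have [->|xc] := eqVneq x c; first by rewrite mem_set// mulr1.
rewrite memNset ?mulr0; last exact/eqP.
by apply/le_anti; rewrite f0 andbT leNgt; apply/negP; have [] := fc x.
Qed.

End lebesgue_rV_facts.

(** * From homothetic log-concave densities to the representation *)

Lemma lneK_ge0 (R : realType) (s : R) : 0 <= s -> expeR (lne s%:E) = s%:E.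
Proof. by move=> s0; rewrite lneK// in_itv/= lee_fin s0 leey. Qed.

Lemma le_lne_EFin (R : realType) (s t : R) : 0 <= s -> 0 <= t ->
  (lne s%:E <= lne t%:E)%E = (s <= t).
Proof. by move=> s0 t0; rewrite -lee_expeR !lneK_ge0// lee_fin. Qed.

Lemma upper_semicontinuous_near (R : realType) (X : topologicalType)
    (g : X -> \bar R) x a :
  upper_semicontinuous_on [set: X] g -> (g x < a%:E)%E ->
  \forall y \near x, (g y < a%:E)%E.
Proof.
by move=> gusc /(gusc _ _ I); apply: (@filterS _ (nbhs x)) => y /(_ I).
Qed.

Lemma usc_superlevel_closed (R : realType) (X : topologicalType)
    (g : X -> R) (t : R) :
  upper_semicontinuous_on [set: X] (fun x => (g x)%:E) ->
  closed [set x | t <= g x].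
Proof.
move=> gusc; rewrite -[X in closed X]setCK closedC.
rewrite openE => x /= /negP; rewrite -ltNge => gx.
apply: filterS (upper_semicontinuous_near gusc (_ : (g x)%:E < t%:E)%E) => [y|].
  by rewrite /= lte_fin ltNge => /negP.
by rewrite lte_fin.
Qed.

Section homothetic_log_concave.
Variables (R : realType) (p : nat) (f : 'rV[R]_p -> R).
Hypotheses (p_gt0 : (0 < p)%N) (f_density : is_density f).

Lemma log_concave_superlevel_convex (t : R) : log_concave f -> 0 < t ->
  convex_set ([set x | t <= f x] : set (convex_lmodType 'rV[R]_p)).
Proof.
move=> fc t0; have f0 := density_ge0 f_density.
apply/convex_set_combine => x y a /andP[a0 a1] /= fx fy.
(* [econcave_on] speaks only of weights strictly between 0 and 1, so both end points are treated
   apart. *)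
move: a0; rewrite le_eqVlt => /predU1P[<-|a0].
  by rewrite scale0r add0r subr0 scale1r.
move: a1; rewrite le_eqVlt => /predU1P[->|a1].
  by rewrite subrr scale0r addr0 scale1r.
have := fc x y a I I; rewrite a0 a1 => /(_ isT).
rewrite -(@le_lne_EFin _ t) ?(ltW t0)//; apply: le_trans.
have -> : lne t%:E = (a%:E * lne t%:E + (1 - a)%:E * lne t%:E)%E.
  by rewrite lne_EFin// -!EFinM -EFinD -mulrDl addrC subrK mul1r.
apply: leeD; apply: lee_wpmul2l; rewrite ?lee_fin ?subr_ge0 ?(ltW a0) ?(ltW a1)//.
  by rewrite le_lne_EFin// ltW.
by rewrite le_lne_EFin// ltW.
Qed.

Lemma homothetic_log_concave_rep :
  upper_semicontinuous_on [set: 'rV[R]_p] (fun x => (f x)%:E) ->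
  homothetic f -> log_concave f ->
  exists (K : set 'rV[R]_p) (mu : 'rV[R]_p) (phi : R -> \bar R),
    homothetic_rep f K mu phi.
Proof.
move=> fusc [r [A [mu [r_ge0 _ _ A0 fr]]]] fc.
have f0 := density_ge0 f_density.
have f_sup x (t : R) : t < f x -> (t%:E < sup_norm f)%E.
  move=> tx; apply: (@lt_le_trans _ _ (f x)%:E); first by rewrite lte_fin.
  by apply: ereal_sup_ubound; exists x.
have [x0 x0mu fx0] := density_support_neq f_density mu p_gt0.
(* Halving puts [t0] strictly below the supremum, as [fr] requires; the superlevel set at [t0]
   contains [x0], which differs from [mu], so its radius is nonzero. *)
pose t0 := f x0 / 2.
have t00 : 0 < t0 by rewrite divr_gt0.
have t0x : t0 < f x0 by rewrite /t0; lra.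
have := fr t0 t00 (f_sup _ _ t0x); set L := [set x | _] => LE.
have rt : 0 < r t0.
  rewrite lt_neqAle r_ge0 ?(f_sup x0)// andbT eq_sym.
  apply/eqP => rt; have : L x0 by exact: ltW.
  by rewrite LE => -[a _]; rewrite rt scale0r add0r => /esym/eqP; apply/negP.
(* [A] is the preimage of [L] under an invertible affine map; boundedness, closedness and convexity
   of [L] are carried over to [A]. *)
have AL a : A a <-> L (r t0 *: a + mu).
  rewrite LE; split=> [Aa|[b Ab] /addIr]; first by exists a.
  by move=> /scalerI; rewrite gt_eqF// => /(_ isT) <-.
have Lc : convex_set (L : set (convex_lmodType 'rV[R]_p)).
  exact: log_concave_superlevel_convex.
have Lmu : L° mu.
  have /nbhs_ballP[e /= e0 eA] := A0.
  apply/nbhs_ballP; exists (r t0 * e) => /=; first exact: mulr_gt0.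
  move=> y; rewrite -ball_normE /= => ye.
  have -> : y = r t0 *: ((r t0)^-1 *: (y - mu)) + mu.
    by rewrite scalerA divff ?gt_eqF// scale1r subrK.
  apply/AL/eA; rewrite -ball_normE /= sub0r normrN normrZ.
  by rewrite gtr0_norm ?invr_gt0// mulrC ltr_pdivrMr// distrC mulrC.
have [M LM] := convex_finite_measure_bounded Lc Lmu
  (density_superlevel_measurable f_density t0)
  (density_superlevel_finite f_density t00).
have bodyA : convex_body0 A.
  split; last exact: A0.
  - apply: bounded_closed_compact.
      exists ((r t0)^-1 * M); split; first exact: num_real.
      move=> B MB a /AL/LM; rewrite addrK normrZ gtr0_norm// => aM.
      by apply/ltW/(le_lt_trans _ MB); rewrite mulrC ler_pdivlMr// mulrC.
    have -> : A = (fun a : 'rV[R]_p => r t0 *: a + mu) @^-1` L.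
      by apply/seteqP; split=> a; [move/AL|move=> La; exact/AL].
    apply: closed_comp; last exact: usc_superlevel_closed.
    move=> a _; apply: continuousD; last by apply: cst_continuous.
    by apply: scaler_continuous.
  apply/convex_set_combine => x y a a01 /AL Ax /AL Ay; apply/AL.
  have -> : r t0 *: (a *: x + (1 - a) *: y) + mu =
      a *: (r t0 *: x + mu) + (1 - a) *: (r t0 *: y + mu).
    by apply/rowP => i; rewrite !mxE; ring.
  by move/convex_set_combine : Lc; apply.
(* If [f x < f y], the level halfway between them is admissible; its superlevel set contains [y],
   hence also [x], whose gauge is no larger. *)
have fle x y :
    minkowski_functional A (x - mu) <= minkowski_functional A (y - mu) ->
    f y <= f x.
  have mem z (t : R) : 0 < t -> (t%:E < sup_norm f)%E ->
      t <= f z <-> minkowski_functional A (z - mu) <= r t.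
    move=> t1 ts; rewrite (minkowski_le bodyA) ?r_ge0//.
    have /seteqP[sub1 sub2] := fr t t1 ts.
    split=> [/sub1[a Aa <-]|[a Aa ax]]; first by exists a; rewrite ?addrK.
    by apply: sub2; exists a => //; rewrite ax subrK.
  move=> xy; rewrite leNgt; apply/negP => fxy.
  pose t := (f x + f y) / 2.
  have tx : f x < t by rewrite /t; lra.
  have ty : t < f y by rewrite /t; lra.
  have t1 : 0 < t := le_lt_trans (f0 x) tx.
  have ts := f_sup _ _ ty.
  have /(mem y _ t1 ts)/(le_trans xy)/(mem x _ t1 ts) := ltW ty.
  by rewrite leNgt tx.
have [u u1] := minkowski_unit bodyA p_gt0.
have us (s : R) : 0 <= s -> minkowski_functional A (mu + s *: u - mu) = s.
  by move=> s0; rewrite addrAC subrr add0r minkowskiZ// u1 mulr1.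
exists A, mu, (fun s => lne (f (mu + s *: u))%:E).
split => //; last first.
  move=> x; have m0 := minkowski_ge0 bodyA (x - mu).
  by rewrite lneK_ge0//; congr EFin; apply/le_anti; rewrite !fle ?us.
split.
- by move=> s _ /=; case: ifP => _ //; exact: ltry.
- move=> s a _; rewrite -lte_expeR lneK_ge0//= => fa.
  have near_f := upper_semicontinuous_near fusc fa.
  have uc : {for s, continuous (fun s : R => mu + s *: u)}.
    apply: continuousD; first by apply: cst_continuous.
    by apply: scalel_continuous.
  apply: (@filterS _ (nbhs s)) (uc _ near_f) => z /= fz _.
  by rewrite -lte_expeR lneK_ge0.
- move=> x y t x0' y0' t01.
  have := fc (mu + x *: u) (mu + y *: u) t I I t01.
  rewrite (_ : t *: _ + _ = mu + (t *: (x : R^o) + (1 - t) *: (y : R^o)) *: u)//.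
  by apply/rowP => i; rewrite !mxE /GRing.scale/=; ring.
- move=> s t /andP[s0 st]; rewrite le_lne_EFin//; apply: fle.
  by rewrite !us// (le_trans s0).
Qed.

End homothetic_log_concave.

(** * From the representation to homothetic log-concave densities *)

Section homothetic_rep_facts.
Variables (R : realType) (p : nat) (f : 'rV[R]_p -> R).
Variables (K : set 'rV[R]_p) (mu : 'rV[R]_p) (phi : R -> \bar R).
Hypotheses (p_gt0 : (0 < p)%N) (f_density : is_density f).
Hypothesis f_rep : homothetic_rep f K mu phi.

Lemma homothetic_rep_anti x y :
  minkowski_functional K (x - mu) <= minkowski_functional K (y - mu) ->
  f y <= f x.
Proof.
have [bodyK [_ _ _ phi_anti] fE] := f_rep => xy.
by rewrite -lee_fin !fE lee_expeR phi_anti// minkowski_ge0.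
Qed.

Lemma homothetic_rep_max x : f x <= f mu.
Proof.
have [bodyK _ _] := f_rep; apply: homothetic_rep_anti.
by rewrite subrr minkowski0// minkowski_ge0.
Qed.

(** The density determines its profile along a ray of unit gauge; two profiles are compared through
    such rays. *)
Lemma homothetic_rep_radial :
  exists u, forall s, 0 <= s -> (f (mu + s *: u))%:E = expeR (phi s).
Proof.
have [bodyK _ fE] := f_rep; have [u u1] := minkowski_unit bodyK p_gt0.
by exists u => s s0; rewrite fE addrAC subrr add0r minkowskiZ// u1 mulr1.
Qed.

(** Otherwise the whole space is a convex set of finite measure, hence bounded. This is what makes
    the radii of superlevel sets finite. *)
Lemma density_lt_somewhere (t : R) : 0 < t -> exists x, f x < t.
Proof.
move=> t0; apply/not_existsP => ft.
have /= LT := density_superlevel_finite f_density t0.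
have mL := density_superlevel_measurable f_density t.
have LE : [set x | t <= f x] = setT.
  by apply/seteqP; split=> // x _ /=; rewrite leNgt; exact/negP.
rewrite LE in LT mL.
have [| |M MP] := @convex_finite_measure_bounded R p setT 0 _ _ mL LT.
- exact/convex_set_combine.
- by rewrite interiorT.
pose w : 'rV[R]_p := const_mx 1.
have w0 : 0 < `|w|.
  rewrite normr_gt0; apply/eqP => /matrixP/(_ ord0 (Ordinal p_gt0)).
  by rewrite !mxE => /eqP; rewrite oner_eq0.
have := MP (((`|M| + 1) / `|w|) *: w) I.
rewrite subr0 normrZ ger0_norm ?divr_ge0 ?addr_ge0// divfK ?gt_eqF//.
by apply/negP; rewrite -ltNge ltr_pwDr// ler_norm.
Qed.

(** The top level [f mu] is included, since uniqueness compares the other superlevel sets with that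
    one. *)
Lemma homothetic_rep_superlevel : exists r : R -> R, forall t, 0 < t <= f mu ->
  [/\ 0 <= r t,
      forall s, 0 <= s -> (t%:E <= expeR (phi s))%E <-> s <= r t &
      [set x | t <= f x] = scale_translate (r t) K mu].
Proof.
have [bodyK [phi_fin phi_usc _ phi_anti] fE] := f_rep.
pose D t := [set s | 0 <= s /\ (t%:E <= expeR (phi s))%E].
exists (fun t => sup (D t)) => t /andP[t0 tmu].
have D0 : D t 0.
  split=> //; rewrite -(minkowski0 bodyK) -[X in minkowski_functional K X](subrr mu).
  by rewrite -fE lee_fin.
have supD : has_sup (D t).
  split; first by exists 0.
  have [x fx] := density_lt_somewhere t0.
  exists (minkowski_functional K (x - mu)) => s [s0 ts].
  rewrite leNgt; apply/negP => /ltW xs; move: fx; apply/negP; rewrite -leNgt.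
  by rewrite -lee_fin fE (le_trans ts)// lee_expeR phi_anti// minkowski_ge0.
have r0 : 0 <= sup (D t) by exact: ub_le_sup supD.2 _ D0.
have tE : t%:E = expeR (ln t)%:E by rewrite /= lnK.
have supDE s : 0 <= s -> (t%:E <= expeR (phi s))%E <-> s <= sup (D t).
  move=> s0; split=> [ts|sr]; first exact: ub_le_sup supD.2 _ _.
  suff : (t%:E <= expeR (phi (sup (D t))))%E.
    by move/le_trans; apply; rewrite lee_expeR phi_anti// s0.
  (* Were [phi] below [ln t] at the supremum, upper semicontinuity would make it so at some nearby
     element [q] of [D t], which is absurd. *)
  rewrite leNgt tE lte_expeR; apply/negP => /(phi_usc _ _ r0).
  move=> /nbhs_ballP[e /= e0 eP].
  have [q [q0 tq] rq] := sup_adherent e0 supD.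
  have qr : q <= sup (D t) by apply: ub_le_sup supD.2 _ _.
  suff : (phi q < (ln t)%:E)%E by rewrite -lte_expeR -tE ltNge tq.
  apply: eP => //; rewrite -ball_normE /= ger0_norm ?subr_ge0//.
  by rewrite ltrBlDr -ltrBlDl.
split=> //; apply/seteqP; split=> [x /= tx|_ [k Kk <-] /=].
  have /(minkowski_le bodyK _ r0)[k Kk kx] :
      minkowski_functional K (x - mu) <= sup (D t).
    by apply/supDE; [exact: minkowski_ge0|rewrite -fE lee_fin].
  by exists k => //; rewrite kx subrK.
rewrite -lee_fin fE addrK; apply/supDE; first exact: minkowski_ge0.
by apply/minkowski_le => //; exists k.
Qed.

Lemma homothetic_rep_homothetic : homothetic f.
Proof.
have [bodyK _ fE] := f_rep; have [r rP] := homothetic_rep_superlevel.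
have lt_sup t : 0 < t -> (t%:E < sup_norm f)%E -> 0 < t <= f mu.
  move=> -> /= ts; rewrite -lee_fin (le_trans (ltW ts))//.
  by apply: ub_ereal_sup => _ [x _ <-]; rewrite lee_fin homothetic_rep_max.
exists r, K, mu; split.
- by move=> t t0 /(lt_sup _ t0)/rP[].
- move=> s t /andP[s0 st] /(lt_sup t (lt_le_trans s0 st)) tM.
  have sM : 0 < s <= f mu by case/andP: tM => _ /(le_trans st) ->; rewrite s0.
  have [rt tr _] := rP t tM; have [_ sr _] := rP s sM.
  by apply/sr => //; apply: (@le_trans _ _ t%:E); rewrite ?lee_fin//; apply/tr.
- by apply: closed_measurable_rV; exact: convex_body0_closed.
- by case: bodyK.
- by move=> t t0 /(lt_sup _ t0)/rP[].
Qed.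

(** A nonincreasing concave function of a convex function is concave, and the gauge is convex. *)
Lemma homothetic_rep_log_concave : log_concave f.
Proof.
have [bodyK [_ _ phi_conc phi_anti] fE] := f_rep.
move=> x y t _ _ t01; rewrite !fE !expeRK.
have /andP[t0 t1] := t01.
apply: le_trans (phi_conc _ _ t _ _ t01) _; try exact: minkowski_ge0.
apply: phi_anti; rewrite minkowski_ge0//=.
rewrite (_ : _ - mu = t *: (x - mu) + (1 - t) *: (y - mu)); last first.
  by apply/rowP => i; rewrite !mxE; ring.
by apply: minkowski_convex; rewrite ?(ltW t0) ?ltW.
Qed.

End homothetic_rep_facts.

(** * Uniqueness *)

Section homothetic_rep_uniqueness.
Variables (R : realType) (p : nat).
Implicit Types (K A B : set 'rV[R]_p) (mu : 'rV[R]_p).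

(** Compactness yields points where the extremes are attained; they differ because [K] contains 0
    and a small constant vector with positive entries. *)
Lemma convex_body0_coord_range K j : convex_body0 K ->
  exists k l, [/\ K k, K l, l ord0 j < k ord0 j &
    forall x, K x -> l ord0 j <= x ord0 j <= k ord0 j].
Proof.
move=> bodyK; have [cK _ K0] := bodyK.
have KN : K !=set0 by exists 0; exact: convex_body0_0.
have jK : {within K, continuous (fun x : 'rV[R]_p => x ord0 j)}.
  by apply: continuous_subspaceT => x; exact: coord_continuous.
have [k /set_mem Kk kmax] := EVT_max_rV KN cK jK.
have [l /set_mem Kl lmin] := EVT_min_rV KN cK jK.
have kl x : K x -> l ord0 j <= x ord0 j <= k ord0 j.
  by move=> Kx; rewrite kmax ?lmin ?inE.
exists k, l; split => //.
have /nbhs_ballP[e /= e0 eK] := K0.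
have /kl/andP[_ lt_k] : K (const_mx (e / 2)).
  apply: eK; split => // i i'; rewrite /ball/= !mxE sub0r normrN gtr0_norm; lra.
have /kl/andP[le_l _] := convex_body0_0 bodyK.
by move: lt_k le_l; rewrite !mxE; lra.
Qed.

(** Used in both directions for two equal sets, with extremal [k] and [l], this and its analogue for
    minima become equalities. *)
Lemma scale_translate_coord_max A B (a b : R) mu nu (k l : 'rV[R]_p) j :
  0 <= b -> A k -> (forall x, B x -> x ord0 j <= l ord0 j) ->
  scale_translate a A mu `<=` scale_translate b B nu ->
  a * k ord0 j + mu ord0 j <= b * l ord0 j + nu ord0 j.
Proof.
move=> b0 Ak Bl /(_ (a *: k + mu))[|x Bx]; first by exists k.
by move/matrixP/(_ ord0 j); rewrite !mxE => <-; rewrite lerD2r ler_wpM2l// Bl.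
Qed.

Lemma scale_translate_coord_min A B (a b : R) mu nu (k l : 'rV[R]_p) j :
  0 <= b -> A k -> (forall x, B x -> l ord0 j <= x ord0 j) ->
  scale_translate a A mu `<=` scale_translate b B nu ->
  b * l ord0 j + nu ord0 j <= a * k ord0 j + mu ord0 j.
Proof.
move=> b0 Ak Bl /(_ (a *: k + mu))[|x Bx]; first by exists k.
by move/matrixP/(_ ord0 j); rewrite !mxE => <-; rewrite lerD2r ler_wpM2l// Bl.
Qed.

Variable f : 'rV[R]_p -> R.
Hypotheses (p_gt0 : (0 < p)%N) (f_density : is_density f).

(** [f] is [m] times the indicator of [S], and total mass 1 forces [S] to have measure [m^-1]. *)
Lemma density_constant_uniform (m : R) :
  0 < m -> (forall x, 0 < f x -> f x = m) -> uniform_density f.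
Proof.
move=> m0 fm; pose S : set (borel_rV R p) := [set x | m <= f x].
have mS : measurable S := density_superlevel_measurable f_density m.
have fS x : f x = m * \1_S x.
  rewrite indicE; case: (boolP (x \in S)) => [/set_mem/= Sx|/negP xS].
    by rewrite mulr1 fm// (lt_le_trans m0).
  rewrite mulr0; apply/le_anti; rewrite density_ge0// andbT leNgt.
  by apply/negP => fx; apply: xS; rewrite inE /S/= (fm _ fx).
have fB B : measurable (B : set (borel_rV R p)) ->
    (\int[lebesgue_rV (R := R) (p := p)]_(x in B) (f x)%:E =
     m%:E * lebesgue_rV ((B : set (borel_rV R p)) `&` S))%E.
  move=> mB; under eq_integral do rewrite fS.
  by rewrite integral_const_indic// ltW.
have Sfin := density_superlevel_finite f_density m0.
have [_ _] := f_density; rewrite fB// setTI => mS1.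
have SE : lebesgue_rV S = (m^-1)%:E.
  move: mS1 Sfin; rewrite -/S; case: (lebesgue_rV S) => [c||]//; last first.
    by rewrite mulrNy gtr0_sg// mul1e.
  rewrite -EFinM => /eqP; rewrite eqe => /eqP mc _; congr EFin.
  have mn : m != 0 by rewrite gt_eqF.
  by apply: (mulfI mn); rewrite mc divff.
exists S; split => [//||B mB]; first by rewrite SE lte_fin invr_gt0 m0 ltry.
by rewrite fB// SE inver gt_eqF ?invr_gt0// invrK muleC.
Qed.

Variables (K K' : set 'rV[R]_p) (mu mu' : 'rV[R]_p) (phi phi' : R -> \bar R).
Hypotheses (rep : homothetic_rep f K mu phi).
Hypotheses (rep' : homothetic_rep f K' mu' phi').

Lemma homothetic_rep_unique :
  (exists sigma sigma' : R,
    [/\ 0 < sigma, 0 < sigma',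
        K' = [set sigma *: k + sigma' *: (mu - mu') | k in K] &
        forall s, 0 <= s -> phi' s = phi (sigma * s)]) /\
  (~ uniform_density f -> mu' = mu).
Proof.
have [bodyK _ fE] := rep; have [bodyK' _ fE'] := rep'.
have fmax := homothetic_rep_max rep.
(* Each centre maximizes [f], so both radius functions are controlled on the same range of
   levels. *)
have fmu : f mu' = f mu.
  by apply/le_anti; rewrite fmax (homothetic_rep_max rep').
have [r rP] := homothetic_rep_superlevel p_gt0 f_density rep.
have [r' rP'] := homothetic_rep_superlevel p_gt0 f_density rep'.
rewrite fmu in rP'.
have coord j : exists k l k' l' : R, [/\ l < k, l' < k' &
    forall t, 0 < t <= f mu ->
      r t * k + mu ord0 j = r' t * k' + mu' ord0 j /\
      r t * l + mu ord0 j = r' t * l' + mu' ord0 j].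
  have [k [l [Kk Kl lk kl]]] := convex_body0_coord_range j bodyK.
  have [k' [l' [Kk' Kl' lk' kl']]] := convex_body0_coord_range j bodyK'.
  exists (k ord0 j), (l ord0 j), (k' ord0 j), (l' ord0 j); split => // t t0.
  have [rt0 _ fr] := rP t t0; have [rt0' _ fr'] := rP' t t0.
  have := fr'; rewrite fr => /seteqP[s1 s2].
  split; apply/le_anti/andP; split.
  - by apply: (scale_translate_coord_max _ Kk _ s1) => // x /kl'/andP[].
  - by apply: (scale_translate_coord_max _ Kk' _ s2) => // x /kl/andP[].
  - by apply: (scale_translate_coord_min _ Kl' _ s2) => // x /kl/andP[].
  - by apply: (scale_translate_coord_min _ Kl _ s1) => // x /kl'/andP[].
have [sigma sigma0 rE] : exists2 sigma, 0 < sigma &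
    forall t, 0 < t <= f mu -> r t = sigma * r' t.
  have [k [l [k' [l' [lk lk' E]]]]] := coord (Ordinal p_gt0).
  (* Subtracting the two identities of [coord] cancels the translations and leaves
     [r t * (k - l) = r' t * (k' - l')]. *)
  exists ((k' - l') / (k - l)); first by rewrite divr_gt0 ?subr_gt0.
  move=> t tP; have [E1 E2] := E t tP.
  have kl0 : k - l != 0 by rewrite subr_eq0 gt_eqF.
  apply: (mulIf kl0); rewrite mulrAC divfK//; lra.
have [x0 x0mu fx0] := density_support_neq f_density mu p_gt0.
have t0P : 0 < f x0 <= f mu by rewrite fx0 fmax.
have r0 : 0 < r (f x0).
  have [rt0 _ fr] := rP _ t0P; rewrite lt_neqAle rt0 andbT eq_sym.
  apply/eqP => rt; have : [set x | f x0 <= f x] x0 by exact: lexx.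
  by rewrite fr => -[a _]; rewrite rt scale0r add0r => /esym/eqP; apply/negP.
have r0' : 0 < r' (f x0) by move: r0; rewrite rE// pmulr_rgt0.
split; last first.
  apply: contra_notP => /eqP mu_neq.
  have [j jmu] : exists j, mu ord0 j != mu' ord0 j.
    apply/not_existsP => mueq; move/eqP: mu_neq; apply; apply/rowP => j.
    by apply/esym/eqP/negPn/negP/mueq.
  have [k [l [k' [l' [_ _ E]]]]] := coord j.
  (* The right-hand side is nonzero for this [j], so [k' - sigma * k] is nonzero too and [r' t] is
     the same at all levels. *)
  have rdiff t : 0 < t <= f mu ->
      r' t * (k' - sigma * k) = mu ord0 j - mu' ord0 j.
    by move=> t0; have [E1 _] := E t t0; move: E1; rewrite rE//; lra.
  have c0 : k' - sigma * k != 0.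
    apply: contraNneq jmu => c0; rewrite -subr_eq0 -(rdiff _ t0P) c0 mulr0//.
  have M0 : 0 < f mu <= f mu by rewrite lexx andbT (lt_le_trans fx0).
  apply: (@density_constant_uniform (f mu)); first by case/andP: M0.
  move=> x fx; have tP : 0 < f x <= f mu by rewrite fx fmax.
  apply/le_anti; rewrite fmax/=.
  have rr : r (f x) = r (f mu).
    by rewrite !rE//; congr (_ * _); apply: (mulIf c0); rewrite !rdiff.
  have [_ _ frx] := rP _ tP; have [_ _ frM] := rP _ M0.
  suff : [set y | f mu <= f y] x by [].
  by rewrite frM -rr -frx /=.
(* Solving [r' K' + mu' = sigma r' K + mu] for [K'] at the level [f x0] gives this factor of
   [mu - mu']. *)
exists sigma, (r' (f x0))^-1; split => //.
- by rewrite invr_gt0.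
- have [_ _ fr] := rP _ t0P; have [_ _ fr'] := rP' _ t0P.
  have SE := fr'; rewrite fr rE// in SE.
  have rn : r' (f x0) != 0 by rewrite gt_eqF.
  apply/seteqP; split=> [x K'x|_ [k Kk <-]].
    have : scale_translate (r' (f x0)) K' mu' (r' (f x0) *: x + mu').
      by exists x.
    rewrite -SE => -[k Kk kx]; exists k => //; apply: (scalerI rn).
    apply: (addIr mu'); rewrite -kx; apply/rowP => i; rewrite !mxE.
    by field.
  have : scale_translate (sigma * r' (f x0)) K mu
      ((sigma * r' (f x0)) *: k + mu).
    by exists k.
  rewrite SE => -[x K'x xk].
  suff -> : sigma *: k + (r' (f x0))^-1 *: (mu - mu') = x by [].
  apply: (scalerI rn); apply: (addIr mu'); rewrite xk; apply/rowP => i.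
  by rewrite !mxE; field.
- move=> s s0; apply: expeR_inj.
  have ss0 : 0 <= sigma * s by rewrite mulr_ge0// ltW.
  have [u uE] := homothetic_rep_radial p_gt0 rep.
  have [u' uE'] := homothetic_rep_radial p_gt0 rep'.
  have f0 := density_ge0 f_density.
  rewrite -uE// -uE'//; congr EFin.
  (* Both sides say that [s <= r' t], equivalently [sigma * s <= r t]. Taking for [t] each of the
     two values in turn, when positive, shows that they are equal. *)
  have iff t : 0 < t <= f mu ->
      t <= f (mu' + s *: u') <-> t <= f (mu + (sigma * s) *: u).
    move=> tP; have [_ tr _] := rP t tP; have [_ tr' _] := rP' t tP.
    rewrite -!lee_fin uE// uE'//; split.
      by move/(tr' s s0) => str; apply/tr => //; rewrite rE// ler_pM2l.
    by move/(tr _ ss0); rewrite rE// ler_pM2l// => /(tr' s s0).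
  apply/le_anti/andP; split.
    have [/le_trans->//|fs] := leP (f (mu' + s *: u')) 0.
    by apply/iff; rewrite ?fs ?fmax ?lexx.
  have [/le_trans->//|fs] := leP (f (mu + (sigma * s) *: u)) 0.
  by apply/iff; rewrite ?fs ?fmax ?lexx.
Qed.

End homothetic_rep_uniqueness.

Theorem proposition2 (R : realType) (p : nat) (p_gt0 : (0 < p)%N)
    (f : 'rV[R]_p -> R)
    (f_density : is_density f)
    (f_usc : upper_semicontinuous_on [set: 'rV[R]_p] (fun x => (f x)%:E)) :
  (homothetic f /\ log_concave f <->
    exists (K : set 'rV[R]_p) (mu : 'rV[R]_p) (phi : R -> \bar R),
      homothetic_rep f K mu phi) /\
  (forall (K K' : set 'rV[R]_p) (mu mu' : 'rV[R]_p) (phi phi' : R -> \bar R),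
    homothetic_rep f K mu phi -> homothetic_rep f K' mu' phi' ->
    (exists sigma sigma' : R,
      [/\ 0 < sigma, 0 < sigma',
          K' = [set sigma *: k + sigma' *: (mu - mu') | k in K] &
          forall s, 0 <= s -> phi' s = phi (sigma * s)]) /\
    (~ uniform_density f -> mu' = mu)).
Proof.
split; last by move=> K K' mu mu' phi phi'; exact: homothetic_rep_unique.
split=> [[fh fc]|[K [mu [phi rep]]]]; first exact: homothetic_log_concave_rep.
split; first exact: (homothetic_rep_homothetic p_gt0 f_density rep).
exact: (homothetic_rep_log_concave rep).
Qed.
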